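(* Let $\varepsilon=1$ and $F=-\nabla_xU$. Suppose that the numerical solution of the filtered two-step variational integrator FVI with stepsize $h$ remains in a compact set independent of $h$. Let $S\in\mathbb{R}^{3\times3}$ be a skew-symmetric matrix such that the invariance conditions $$U(e^{\tau S}x)=U(x)\quad\text{and}\quad e^{-\tau S}A(e^{\tau S}x)=A(x)\qquad\text{for all real }\tau$$ hold, and assume further that $S\tilde B_0^2=\tilde B_0^2S$. Let $N\ge3$ be an integer (the truncation number). Then the momentum $M(x,v)=(v+A(x))^{\intercal}Sx$ is nearly conserved along the numerical solution: $$\big|M(x_{n+1/2},v_{n+1/2})-M(x_{1/2},v_{1/2})\big|\le Ch^2\qquad\text{for } nh\le ch^{-N+2},$$ where $c$ is a constant independent of $h$ and $C$ is a constant independent of $n$ and $h$ with $nh\le ch^{-N+2}$.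
   Context: System ($\varepsilon=1$): $\ddot x(t)=\dot x(t)\times B(x(t))+F(x(t))$, $x(t)\in\mathbb{R}^3$, $v:=\dot x$, with $B(x)=B_0+B_1(x)$, where $B_0\in\mathbb{R}^3$ is a fixed vector with $|B_0|=1$ ($|\cdot|$ is the Euclidean norm), $B_1:\mathbb{R}^3\to\mathbb{R}^3$ is a non-constant magnetic field with known vector potential $A_1$, and $F:\mathbb{R}^3\to\mathbb{R}^3$; $B_1$ and $F$ are smooth and bounded, and $F=-\nabla_xU$ with scalar potential $U$. The full vector potential is $A(x)=-\tfrac12 x\times B_0+A_1(x)$, so $B=\nabla_x\times A$. $A'(x)=(\partial_jA_i(x))_{i,j=1}^3$ is the Jacobian. The initial data satisfy $|x(0)|\le\hat C$, $|\dot x(0)|\le\hat C$. Filters: $\tilde B_0$ is the skew-symmetric matrix with $-\tilde B_0v=v\times B_0$ for all $v\in\mathbb{R}^3$; $\operatorname{tanc}(\zeta)=\tan(\zeta)/\zeta$, $\operatorname{sinc}(\zeta)=\sin(\zeta)/\zeta$; $$\Psi=I+\big(1-\operatorname{tanc}(\tfrac h2)\big)\tilde B_0^2,\qquad \Phi=I+\big(1-\operatorname{sinc}(\tfrac h2)^{-1}\big)\tilde B_0^2 .$$ Method FVI: $t_n=nh$, $x_0=x(0)$, $v_0=\dot x(0)$, $x_{n\pm1/2}:=(x_n+x_{n\pm1})/2$, and for $n\ge1$ $$x_{n+1}-2x_n+x_{n-1}=\Psi\Big(\tfrac h2A'(x_{n+1/2})^{\intercal}(x_{n+1}-x_n)+\tfrac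 h2A'(x_{n-1/2})^{\intercal}(x_n-x_{n-1})-h\big(A(x_{n+1/2})-A(x_{n-1/2})\big)+\tfrac{h^2}2\big(F(x_{n+1/2})+F(x_{n-1/2})\big)\Big).$$ The starting value $x_1$ is defined by $x_1=x_0+h\Psi\big(p_0+\tfrac12A'(x_{1/2})^{\intercal}(x_1-x_0)-A(x_{1/2})+\tfrac h2F(x_{1/2})\big)$ with $p_0=v_0+A(x_0)$ and $x_{1/2}=(x_0+x_1)/2$. The velocities are defined for $n\ge0$ by $v_{n+1/2}:=\dfrac{v_{n+1}+v_n}{2}=\Phi\,\dfrac{x_{n+1}-x_n}{h}$. *)

(* Defs.v *)
From HB Require Import structures.
From mathcomp Require Import all_boot all_order all_algebra.
From mathcomp Require Import ring.
From mathcomp Require Import all_classical all_reals all_analysis.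
Set Implicit Arguments.
Unset Strict Implicit.
Unset Printing Implicit Defensive.
Import Order.TTheory GRing.Theory Num.Theory.
Import numFieldNormedType.Exports.
Local Open Scope classical_set_scope.
Local Open Scope ring_scope.

(* Vectors of R^3 are column vectors 'cV[R]_3. *)

(* The library norm on matrices is the sup norm, hence a separate name for the
   Euclidean one. *)
Definition enorm (R : realType) (x : 'cV[R]_3) : R :=
  Num.sqrt (\sum_i x i 0 ^+ 2).

(* Indices are taken mod 3: (x × y)_i = x_(i+1) y_(i+2) - x_(i+2) y_(i+1). *)
Definition crossv (R : realType) (x y : 'cV[R]_3) : 'cV[R]_3 :=
  \col_(i < 3) (x (i + 1) 0 * y (i + 2%:R) 0 - x (i + 2%:R) 0 * y (i + 1) 0).

Definition partial (R : realType) (j : 'I_3) (f : 'cV[R]_3 -> R)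
  (x : 'cV[R]_3) : R := 'D_(delta_mx j 0 : 'cV[R]_3) f x.

Definition grad (R : realType) (f : 'cV[R]_3 -> R) (x : 'cV[R]_3) : 'cV[R]_3 :=
  \col_(i < 3) partial i f x.

Definition jac (R : realType) (f : 'cV[R]_3 -> 'cV[R]_3) (x : 'cV[R]_3)
  : 'M[R]_3 := \matrix_(i, j) partial j (fun y => f y i 0) x.

Definition curl (R : realType) (f : 'cV[R]_3 -> 'cV[R]_3) (x : 'cV[R]_3)
  : 'cV[R]_3 :=
  \col_(i < 3) (jac f x (i + 2%:R) (i + 1) - jac f x (i + 1) (i + 2%:R)).

Fixpoint classC (R : realType) (k : nat) (f : 'cV[R]_3 -> R) : Prop :=
  continuous f /\
  if k is l.+1 then
    forall j : 'I_3,
      (forall x, derivable f x (delta_mx j 0 : 'cV[R]_3)) /\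
      classC l (partial j f)
  else True.

Definition smooth (R : realType) (f : 'cV[R]_3 -> R) : Prop :=
  forall k, classC k f.

Definition smoothv (R : realType) (f : 'cV[R]_3 -> 'cV[R]_3) : Prop :=
  forall i : 'I_3, smooth (fun x => f x i 0).

Definition boundedv (R : realType) (f : 'cV[R]_3 -> 'cV[R]_3) : Prop :=
  exists b : R, forall x, enorm (f x) <= b.

Definition expmx (R : realType) (M : 'M[R]_3) : 'M[R]_3 :=
  limn (series (fun k : nat => (k`!%:R)^-1 *: M ^+ k)).

Definition tanc (R : realType) (z : R) : R := tan z / z.
Definition sinc (R : realType) (z : R) : R := sin z / z.

Definition tildemx (R : realType) (B0 : 'cV[R]_3) : 'M[R]_3 :=
  \matrix_(i, j) - crossv (delta_mx j 0) B0 i 0.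

Lemma tildemxP (R : realType) (B0 v : 'cV[R]_3) :
  - (tildemx B0 *m v) = crossv v B0.
Proof.
apply/colP => i; rewrite !mxE -sumrN.
under eq_bigr => j _ do rewrite !mxE !eqxx !andbT.
rewrite !big_ord_recl big_ord0.
case: i => -[|[|[|//]]] Hi; rewrite /= ?(mulr0n, mulr1n).
all: have E0 : ord0 = 0 :> 'I_3 by apply/val_inj.
all: have E1 : lift ord0 ord0 = 1 :> 'I_3 by apply/val_inj.
all: have E2 : lift ord0 (lift ord0 ord0) = 2%:R :> 'I_3 by apply/val_inj.
all: rewrite ?E0 ?E1 ?E2.
- have -> : Ordinal Hi = 0 by apply/val_inj.
  rewrite !add0r /=; ring.
- have -> : Ordinal Hi = 1 by apply/val_inj.
  have -> : 1 + 2%:R = 0 :> 'I_3 by apply/val_inj.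
  have -> : 1 + 1 = 2%:R :> 'I_3 by apply/val_inj.
  rewrite /=; ring.
- have -> : Ordinal Hi = 2%:R by apply/val_inj.
  have -> : 2%:R + 2%:R = 1 :> 'I_3 by apply/val_inj.
  have -> : 2%:R + 1 = 0 :> 'I_3 by apply/val_inj.
  rewrite /=; ring.
Qed.

Lemma tildemx_skew (R : realType) (B0 : 'cV[R]_3) :
  (tildemx B0)^T = - tildemx B0.
Proof.
have dec (k : 'I_3) : [\/ k = 0, k = 1 | k = 2%:R].
  by case: k => -[|[|[|//]]] Hk; [apply: Or31 | apply: Or32 | apply: Or33];
    apply/val_inj.
have E3 : 1 + 2%:R = 0 :> 'I_3 by apply/val_inj.
have E2 : 1 + 1 = 2%:R :> 'I_3 by apply/val_inj.
have E4 : 2%:R + 2%:R = 1 :> 'I_3 by apply/val_inj.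
have E5 : 2%:R + 1 = 0 :> 'I_3 by apply/val_inj.
apply/matrixP => i j; rewrite !mxE.
by case: (dec i) => ->; case: (dec j) => ->;
  rewrite ?add0r ?E2 ?E3 ?E4 ?E5 /=; ring.
Qed.

Definition Psi (R : realType) (B0 : 'cV[R]_3) (h : R) : 'M[R]_3 :=
  1%:M + (1 - tanc (h / 2)) *: tildemx B0 ^+ 2.

Definition Phi (R : realType) (B0 : 'cV[R]_3) (h : R) : 'M[R]_3 :=
  1%:M + (1 - (sinc (h / 2))^-1) *: tildemx B0 ^+ 2.

Definition vecpot (R : realType) (B0 : 'cV[R]_3)
  (A1 : 'cV[R]_3 -> 'cV[R]_3) (x : 'cV[R]_3) : 'cV[R]_3 :=
  - (1 / 2) *: crossv x B0 + A1 x.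

(* [midpt z n] stands for z_{n+1/2}. *)
Definition midpt (R : realType) (z : nat -> 'cV[R]_3) (n : nat) : 'cV[R]_3 :=
  (1 / 2) *: (z n + z n.+1).

(* x_0, ..., x_L and v_0, ..., v_L are produced by L steps of the method with
   stepsize h, starting from x(0) = x_0 and x'(0) = v_0. The method is
   implicit, so it is given as a relation. *)
Record FVI (R : realType) (B0 : 'cV[R]_3) (A F : 'cV[R]_3 -> 'cV[R]_3)
    (h : R) (L : nat) (x v : nat -> 'cV[R]_3) : Prop := {
  FVI_start :
    x 1%N = x 0%N + h *: (Psi B0 h *m
      ((v 0%N + A (x 0%N)) + (1 / 2) *: ((jac A (midpt x 0%N))^T *m (x 1%N - x 0%N))
       - A (midpt x 0%N) + (h / 2) *: F (midpt x 0%N)));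
  FVI_step : forall n : nat, (1 <= n < L)%N ->
    x n.+1 - 2 *: x n + x n.-1 = Psi B0 h *m
      ((h / 2) *: ((jac A (midpt x n))^T *m (x n.+1 - x n))
       + (h / 2) *: ((jac A (midpt x n.-1))^T *m (x n - x n.-1))
       - h *: (A (midpt x n) - A (midpt x n.-1))
       + (h ^+ 2 / 2) *: (F (midpt x n) + F (midpt x n.-1)));
  FVI_velocity : forall n : nat, (n < L)%N ->
    midpt v n = Phi B0 h *m (h^-1 *: (x n.+1 - x n))
}.

Definition momentum (R : realType) (A : 'cV[R]_3 -> 'cV[R]_3) (S : 'M[R]_3)
  (x v : 'cV[R]_3) : R := ((v + A x)^T *m S *m x) 0 0.

(* Main.v *)
Require Import Defs.
From HB Require Import structures.
From mathcomp Require Import all_boot all_order all_algebra.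
From mathcomp Require Import ring lra.
From mathcomp Require Import all_classical all_reals all_analysis.
Set Implicit Arguments.
Unset Strict Implicit.
Unset Printing Implicit Defensive.
Import Order.TTheory GRing.Theory Num.Theory.
Import numFieldNormedType.Exports.
Local Open Scope classical_set_scope.
Local Open Scope ring_scope.

(** The method is a variational integrator: since [Psi] is symmetric and
    invertible, the two-step recursion is the discrete Euler-Lagrange equation
    of the discrete Lagrangian
      [h / 2 * (u^T Psi^-1 u) + h * (A(m)^T u) - h * U(m)],
    where [m] is the midpoint of a step and [u] its difference quotient. Because
    [S] commutes with [tildemx B0 ^+ 2], hence with [Psi], this Lagrangian is
    invariant under the flow [expmx (t *: S)], and the discrete Noether theorem
    yields a quantity that the numerical solution conserves exactly
    ([discrete_momentum_constant]). The argument needs the invariance conditions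
    in infinitesimal form, [F(x)^T S x = 0] and [A'(x) S x = S A(x)]
    ([invariant_gradient], [equivariant_jacobian]).

    Written at the midpoint, the conserved quantity is
      [(Psi^-1 u + A(m))^T S m + (h^2 / 4) u^T A'(m) S u + (h^2 / 4) F(m)^T S u],
    whereas the momentum of the theorem is [(Phi u + A(m))^T S m]. As
    [Phi - Psi^-1] is [O(h^2)] ([filters_close]), the two differ by [O(h^2)] with
    a constant that is uniform in [n] and [h] as soon as [u] is bounded uniformly
    ([momentum_defect]), and the estimate follows for any number of steps.

    It remains to bound [u] independently of [n] and [h]
    ([FVI_velocity_bound]). For large [h] this is the boundedness of the
    positions. For small [h] the velocity changes in one step by at most a
    constant times [h * (1 + speed)], so a particle of large speed would keep its
    direction during a fixed time and leave the compact set which contains the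
    numerical solution ([bounded_trajectory_velocity]). *)

(** * Sup norm and limits of matrices *)

Lemma norm_coord_le (R : realType) m n (M : 'M[R]_(m, n)) i j :
  `|M i j| <= `|M|.
Proof.
rewrite [leRHS]/Num.norm /= mx_normrE.
exact: (le_bigmax _ (fun ij => `|M ij.1 ij.2|) (i, j)).
Qed.

Lemma norm_mx_le (R : realType) m n (M : 'M[R]_(m, n)) (c : R) :
  0 <= c -> (forall i j, `|M i j| <= c) -> `|M| <= c.
Proof.
by move=> c0 Mc; rewrite [leLHS]/Num.norm /= mx_normrE bigmax_le.
Qed.

Lemma norm_mulmx_le (R : realType) m n p (M : 'M[R]_(m, n)) (N : 'M[R]_(n, p)) :
  `|M *m N| <= n%:R * `|M| * `|N|.
Proof.
apply: norm_mx_le => [|i j]; first by rewrite !mulr_ge0.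
rewrite mxE (le_trans (ler_norm_sum _ _ _))//.
have -> : n%:R * `|M| * `|N| = \sum_(k < n) (`|M| * `|N|).
  by rewrite sumr_const card_ord -mulrA mulr_natl.
by apply: ler_sum => k _; rewrite normrM ler_pM// norm_coord_le.
Qed.

Lemma norm_trmx (R : realType) m n (M : 'M[R]_(m, n)) : `|M^T| = `|M|.
Proof.
have le_tr a b (A : 'M[R]_(a, b)) : `|A^T| <= `|A|.
  by apply: norm_mx_le => // i j; rewrite mxE norm_coord_le.
by apply/le_anti; rewrite le_tr -{1}[M]trmxK le_tr.
Qed.

Lemma norm_le_enorm (R : realType) (x : 'cV[R]_3) : `|x| <= enorm x.
Proof.
apply: norm_mx_le => [|i j]; first exact: sqrtr_ge0.
rewrite (ord1 j) -sqrtr_sqr ler_wsqrtr// (bigD1 i)//= lerDl.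
by apply: sumr_ge0 => k _; exact: sqr_ge0.
Qed.

Lemma cvg_mx_coord (R : realType) m n (T : Type) (F : set_system T)
    (FF : Filter F) (M : T -> 'M[R]_(m, n)) (L : 'M[R]_(m, n)) :
  (M t @[t --> F] --> L) <-> (forall i j, M t i j @[t --> F] --> L i j).
Proof.
split=> [ML i j|ML].
  exact: (cvg_comp _ _ ML (@coord_continuous _ _ _ i j L)).
apply/cvgrPdist_le => e e0.
have : \forall t \near F, forall ij : 'I_m * 'I_n,
    `|L ij.1 ij.2 - M t ij.1 ij.2| <= e.
  apply: filter_forall => -[i j] /=.
  by have /cvgrPdist_le := ML i j; apply.
apply: filterS => t Mt; apply: norm_mx_le; first exact: ltW.
by move=> i j; have := Mt (i, j); rewrite !mxE.
Qed.

Lemma cvg_mulmx (R : realType) m n p (T : Type) (F : set_system T)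
    (FF : Filter F) (M : T -> 'M[R]_(m, n)) (N : T -> 'M[R]_(n, p))
    (M0 : 'M[R]_(m, n)) (N0 : 'M[R]_(n, p)) :
  M t @[t --> F] --> M0 -> N t @[t --> F] --> N0 ->
  M t *m N t @[t --> F] --> M0 *m N0.
Proof.
move=> /cvg_mx_coord MM /cvg_mx_coord NN; apply/cvg_mx_coord => i j.
rewrite mxE; under eq_fun do rewrite mxE.
apply: cvg_big => [|k _]; first exact: add_continuous.
exact: cvgM (MM i k) (NN k j).
Qed.

(** * Mean value theorem and chain rule for functions of class C1 *)

Lemma partial_derivative_along (R : realType) (f : 'cV[R]_3 -> R) (j : 'I_3)
    (p : 'cV[R]_3) (t : R) :
  classC 1 f ->
  is_derive t 1 (fun s => f (p + s *: (delta_mx j 0 : 'cV[R]_3)))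
    (partial j f (p + t *: delta_mx j 0)).
Proof.
move=> [_ /(_ j)[df _]]; set e : 'cV[R]_3 := delta_mx j 0.
have E : (fun h : R => h^-1 *: (((fun s => f (p + s *: e)) \o shift t) (h *: 1)
      - f (p + t *: e))) =
    (fun h : R => h^-1 *: ((f \o shift (p + t *: e)) (h *: e) - f (p + t *: e))).
  apply/funext => h /=; congr (_ *: (f _ - _)).
  by rewrite [h *: 1]mulr1 scalerDl addrCA.
split; first by rewrite /derivable E; exact: df.
by rewrite /derive E.
Qed.

Lemma mean_value_coord (R : realType) (f : 'cV[R]_3 -> R) (j : 'I_3)
    (p : 'cV[R]_3) (t : R) :
  classC 1 f -> exists2 s, `|s| <= `|t| &
    f (p + t *: delta_mx j 0) - f p = partial j f (p + s *: delta_mx j 0) * t.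
Proof.
move=> f1; set g := fun s => f (p + s *: (delta_mx j 0 : 'cV[R]_3)).
have dg s := partial_derivative_along j p s f1.
have cg (I : interval R) : {within [set` I], continuous g}.
  by apply: derivable_within_continuous => s _; have [] := dg s.
have g0 : f p = g 0 by rewrite /g scale0r addr0.
have [t0|t0] := leP 0 t.
  have [s sI E] := MVT_segment t0 (fun s _ => dg s) (cg _).
  exists s; last by rewrite g0 E subr0.
  by move: sI; rewrite in_itv /= => /andP[s0 st]; rewrite !ger0_norm.
have [s sI E] := MVT_segment (ltW t0) (fun s _ => dg s) (cg _).
exists s; last by rewrite g0 -[LHS]opprB E; ring.
move: sI; rewrite in_itv /= => /andP[s0 st].
by rewrite ler0_norm// ler0_norm ?(ltW t0)// lerN2.
Qed.

(** Walking from [p] to [p + d] parallel to the axes turns the one-dimensional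
    mean value theorem into an exact expression of the increment. Lipschitz
    bounds and the chain rule both follow from the location of the intermediate
    points. *)
Lemma mean_value (R : realType) (f : 'cV[R]_3 -> R) (p d : 'cV[R]_3) :
  classC 1 f -> exists2 xi : 'I_3 -> 'cV[R]_3,
    (forall j, `|xi j - p| <= `|d|) &
    f (p + d) - f p = \sum_j partial j f (xi j) * d j 0.
Proof.
move=> f1.
(* [P k] has the first [k] coordinates of [p + d] and the others of [p]. *)
pose P k : 'cV[R]_3 := \col_(i < 3) (p i 0 + (if (i < k)%N then d i 0 else 0)).
have PS (k : 'I_3) : P k.+1 = P k + d k 0 *: delta_mx k 0.
  apply/colP => i; rewrite !mxE eqxx andbT ltnS leq_eqVlt (inj_eq val_inj).
  by case: (eqVneq i k) => [->|_] /=; rewrite ?ltnn; ring.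
have P0 : p = P 0%N by apply/colP => i; rewrite !mxE addr0.
have P3 : p + d = P 3%N by apply/colP => i; rewrite !mxE ltn_ord.
have /choice [s sP] (k : 'I_3) : exists s : R, `|s| <= `|d k 0| /\
    f (P k.+1) - f (P k) = partial k f (P k + s *: delta_mx k 0) * d k 0.
  have [s s1 s2] := mean_value_coord k (P k) (d k 0) f1.
  by exists s; split; rewrite // PS.
exists (fun k : 'I_3 => P k + s k *: delta_mx k 0).
  move=> k; apply: norm_mx_le => // i j; rewrite !mxE (ord1 j) eqxx andbT.
  case: (eqVneq i k) => [->|ik] /=.
    rewrite ltnn addr0 mulr1 addrC addKr.
    exact: le_trans (proj1 (sP k)) (norm_coord_le _ _ _).
  rewrite mulr0 addr0 addrC addKr; case: ifP => _; last by rewrite normr0.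
  exact: norm_coord_le.
rewrite P3 P0 -(telescope_sumr (fun k => f (P k)))// big_mkord.
by apply: eq_bigr => k _; rewrite (proj2 (sP k)).
Qed.

Lemma classC1_partial_continuous (R : realType) (f : 'cV[R]_3 -> R) j :
  classC 1 f -> continuous (partial j f).
Proof. by case=> _ /(_ j)[_ []]. Qed.

(** The intermediate points of [mean_value] are squeezed onto [x] as the curve
    approaches it, where the partial derivatives are continuous. *)
Lemma chain_rule_at0 (R : realType) (f : 'cV[R]_3 -> R) (gam : R -> 'cV[R]_3)
    (x w : 'cV[R]_3) :
  classC 1 f -> t^-1 *: (gam t - x) @[t --> 0^'] --> w ->
  t^-1 * (f (gam t) - f x) @[t --> 0^'] --> \sum_j partial j f x * w j 0.
Proof.
move=> f1 gamw.
have /choice [xi xiP] (t : R) : exists xi : 'I_3 -> 'cV[R]_3,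
    (forall j, `|xi j - x| <= `|gam t - x|) /\
    f (gam t) - f x = \sum_j partial j f (xi j) * (gam t - x) j 0.
  have [xi h1 h2] := mean_value x (gam t - x) f1.
  by exists xi; split=> //; rewrite -h2 addrCA subrr addr0.
have gamx : (gam t - x) @[t --> 0^'] --> (0 : 'cV[R]_3).
  rewrite -[X in _ --> X](scale0r w).
  have : t *: (t^-1 *: (gam t - x)) @[t --> 0^'] --> 0 *: w.
    by apply: cvgZ => //; apply: cvg_within_filter; exact: cvg_id.
  apply: cvg_trans; apply: near_eq_cvg; near=> t.
  rewrite scalerA mulfV ?scale1r//; near: t; exact: nbhs_dnbhs_neq.
have xix j : xi t j @[t --> 0^'] --> x.
  apply/cvgrPdist_le => e e0.
  have /cvgrPdist_le /(_ _ e0) := gamx.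
  apply: filterS => t; rewrite sub0r normrN => h.
  by rewrite distrC (le_trans (proj1 (xiP t) j)).
have -> : (fun t => t^-1 * (f (gam t) - f x)) =
    (fun t => \sum_j partial j f (xi t j) * (t^-1 *: (gam t - x)) j 0).
  apply/funext => t; rewrite (proj2 (xiP t)) mulr_sumr.
  by apply: eq_bigr => j _; rewrite [in RHS]mxE; ring.
apply: cvg_big => [|j _]; first exact: add_continuous.
apply: cvgM; last by move/cvg_mx_coord: gamw; exact.
exact: (cvg_comp _ _ (xix j) (classC1_partial_continuous f1 (x := x))).
Unshelve. all: by end_near. Qed.

(** * The matrix exponential near zero *)

Lemma norm_mx_pow_le (R : realType) (M : 'M[R]_3) k :
  `|M ^+ k| <= (3%:R * `|M|) ^+ k.
Proof.
elim: k => [|k IH].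
  rewrite !expr0; apply: norm_mx_le => // i j.
  by rewrite mxE; case: eqP; rewrite ?normr1 ?normr0.
rewrite !exprS (le_trans (norm_mulmx_le _ _))// ler_wpM2l// mulr_ge0//.
Qed.

Lemma norm_exp_term_le (R : realType) (M : 'M[R]_3) k :
  `|(k`!%:R)^-1 *: M ^+ k| <= exp_coeff (3%:R * `|M|) k.
Proof.
rewrite normrZ ger0_norm ?invr_ge0// /exp_coeff /= mulrC ler_wpM2r ?invr_ge0//.
exact: norm_mx_pow_le.
Qed.

(** [norm_exp_term_le] dominates each entry of the series by a scalar
    exponential series. *)
Lemma expmx_cvg (R : realType) (M : 'M[R]_3) :
  series (fun k => (k`!%:R)^-1 *: M ^+ k) @ \oo --> expmx M.
Proof.
set u := fun k => (k`!%:R)^-1 *: M ^+ k.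
have cvg_entry i j : cvgn (series (fun k => u k i j)).
  apply: normed_cvg.
  apply: (@series_le_cvg _ _ (exp_coeff (3%:R * `|M|))) => [n|n|n|].
  - exact: normr_ge0.
  - by rewrite exp_coeff_ge0// mulr_ge0.
  - exact: le_trans (norm_coord_le _ _ _) (norm_exp_term_le _ _).
  - exact: is_cvg_series_exp_coeff.
have : series u @ \oo --> \matrix_(i, j) limn (series (fun k => u k i j)).
  apply/cvg_mx_coord => i j; rewrite mxE.
  have -> : (fun n => series u n i j) = series (fun k => u k i j).
    by apply/funext => n; rewrite /series /= summxE.
  exact: cvg_entry.
by move=> H; rewrite /expmx -/u (cvg_lim _ H).
Qed.

(** For [`|t| <= 1], each term of order at least two is at most [t ^+ 2] times
    the corresponding term of the exponential series of [3 * `|S|]. *)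
Lemma expmx_taylor1 (R : realType) (S : 'M[R]_3) (t : R) :
  `|t| <= 1 ->
  `|expmx (t *: S) - (1 + t *: S)| <= `|t| ^+ 2 * expR (3%:R * `|S|).
Proof.
move=> t1; set u := fun k => (k`!%:R)^-1 *: (t *: S) ^+ k.
set c := _ * expR _.
have uE k : (2 <= k)%N -> `|u k| <= `|t| ^+ 2 * exp_coeff (3%:R * `|S|) k.
  move=> k2; rewrite (le_trans (norm_exp_term_le _ _))// /exp_coeff /=.
  rewrite normrZ mulrCA exprMn -mulrA ler_wpM2r ?divr_ge0 ?exprn_ge0 ?mulr_ge0//.
  by rewrite ler_wiXn2l.
have close n : `|series u n.+2 - (1 + t *: S)| <= c.
  rewrite /series /= 2?big_nat_recl// {1 2}/u.
  rewrite expr0 expr1 fact0 invr1 !scale1r addrA addrC addrK.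
  rewrite (le_trans (ler_norm_sum _ _ _))//.
  apply: (@le_trans _ _
    (\sum_(0 <= k < n) `|t| ^+ 2 * exp_coeff (3%:R * `|S|) k.+2)).
    by apply: ler_sum => k _; exact: uE.
  rewrite -mulr_sumr ler_wpM2l ?exprn_ge0//.
  apply: (@le_trans _ _ (series (exp_coeff (3%:R * `|S|)) n.+2)).
    rewrite /series /= [leRHS]big_nat_recl// big_nat_recl// addrA lerDr.
    by rewrite addr_ge0// exp_coeff_ge0// mulr_ge0.
  apply: nondecreasing_cvgn_le; last exact: is_cvg_series_exp_coeff.
  apply/nondecreasing_seqP => m; rewrite /series /= big_nat_recr//= lerDl.
  by rewrite exp_coeff_ge0// mulr_ge0.
have lim : `|series u n - (1 + t *: S)| @[n --> \oo] -->
    `|expmx (t *: S) - (1 + t *: S)|.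
  by apply: cvg_norm; apply: cvgB; [exact: expmx_cvg|exact: cvg_cst].
rewrite -(cvg_lim _ lim)//; apply: limr_le; first by apply: cvgP lim.
by exists 2%N => // -[|[|n]]//= _; exact: close.
Qed.

Lemma expmx_derivative_at0 (R : realType) (S : 'M[R]_3) :
  t^-1 *: (expmx (t *: S) - 1) @[t --> (0 : R)^'] --> S.
Proof.
apply/cvgrPdist_le => e e0.
have E0 : 0 < expR (3%:R * `|S|) by exact: expR_gt0.
near=> t.
have t0 : t != 0 by near: t; exact: nbhs_dnbhs_neq.
have t1 : `|t| <= 1 by near: t; exact: dnbhs0_le.
have te : `|t| <= e / expR (3%:R * `|S|).
  by near: t; apply: dnbhs0_le; rewrite divr_gt0.
rewrite distrC -{2}[S]scale1r -(mulVf t0) -scalerA -scalerBr normrZ normfV.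
rewrite -addrA -opprD ler_pdivrMl ?normr_gt0//.
rewrite (le_trans (expmx_taylor1 _ t1))// expr2 -mulrA ler_wpM2l//.
by rewrite -ler_pdivlMr.
Unshelve. all: by end_near. Qed.

Lemma expmx_orbit_velocity (R : realType) (S : 'M[R]_3) (x : 'cV[R]_3) :
  t^-1 *: (expmx (t *: S) *m x - x) @[t --> (0 : R)^'] --> S *m x.
Proof.
have -> : (fun t : R => t^-1 *: (expmx (t *: S) *m x - x)) =
    (fun t => (t^-1 *: (expmx (t *: S) - 1)) *m x).
  by apply/funext => t; rewrite -scalemxAl mulmxBl mul1mx.
by apply: cvg_mulmx; [exact: expmx_derivative_at0|exact: cvg_cst].
Qed.

(** * Infinitesimal form of the invariance conditions *)

Lemma invariant_gradient (R : realType) (U : 'cV[R]_3 -> R) (S : 'M[R]_3) :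
  classC 1 U -> (forall (t : R) x, U (expmx (t *: S) *m x) = U x) ->
  forall x, (grad U x)^T *m (S *m x) = 0.
Proof.
move=> U1 Uinv x.
have H := chain_rule_at0 U1 (@expmx_orbit_velocity _ S x).
apply/matrixP => i j; rewrite (ord1 i) (ord1 j) !mxE.
under eq_bigr do rewrite 2!mxE.
rewrite -(cvg_lim _ H)//; apply: lim_near_cst => //.
by near=> t; rewrite Uinv subrr mulr0.
Unshelve. all: by end_near. Qed.

(** By equivariance, the difference quotient of [A] along the orbit of [x] is
    that of [1 - expmx (- t *: S)], applied to [A (expmx (t *: S) *m x)]. Its
    two expressions have the two sides as limits. *)
Lemma equivariant_jacobian (R : realType) (A : 'cV[R]_3 -> 'cV[R]_3)
    (S : 'M[R]_3) :
  (forall i, classC 1 (fun x => A x i 0)) ->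
  (forall (t : R) x, expmx (- t *: S) *m A (expmx (t *: S) *m x) = A x) ->
  forall x, jac A x *m (S *m x) = S *m A x.
Proof.
move=> A1 Ainv x; have Ex := @expmx_orbit_velocity _ S x.
have slopeA : t^-1 *: (A (expmx (t *: S) *m x) - A x) @[t --> (0 : R)^'] -->
    jac A x *m (S *m x).
  apply/cvg_mx_coord => i j; rewrite (ord1 j).
  have -> : (fun t : R => (t^-1 *: (A (expmx (t *: S) *m x) - A x)) i 0) =
      (fun t : R => t^-1 * (A (expmx (t *: S) *m x) i 0 - A x i 0)).
    by apply/funext => t; rewrite !mxE.
  have -> : (jac A x *m (S *m x)) i 0 =
      \sum_k partial k (fun y => A y i 0) x * (S *m x) k 0.
    by rewrite mxE; apply: eq_bigr => k _; rewrite [X in X * _]mxE.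
  exact: chain_rule_at0.
have AE : A (expmx (t *: S) *m x) @[t --> (0 : R)^'] --> A x.
  have : A x + t *: (t^-1 *: (A (expmx (t *: S) *m x) - A x))
      @[t --> (0 : R)^'] --> A x + 0 *: (jac A x *m (S *m x)).
    apply: cvgD; first exact: cvg_cst.
    by apply: cvgZ => //; apply: cvg_within_filter; exact: cvg_id.
  rewrite scale0r addr0; apply: cvg_trans; apply: near_eq_cvg; near=> t.
  rewrite scalerA mulfV ?scale1r ?subrKC//.
  by near: t; exact: nbhs_dnbhs_neq.
have slopeE : - (t^-1 *: (expmx (t *: - S) - 1)) *m A (expmx (t *: S) *m x)
    @[t --> (0 : R)^'] --> - (- S) *m A x.
  by apply: cvg_mulmx => //; apply: cvgN; exact: expmx_derivative_at0.
have slope_eq : (fun t : R =>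
      - (t^-1 *: (expmx (t *: - S) - 1)) *m A (expmx (t *: S) *m x)) =
    (fun t => t^-1 *: (A (expmx (t *: S) *m x) - A x)).
  apply/funext => t; rewrite -scalerN -scalemxAl opprB mulmxBl mul1mx.
  have -> : t *: - S = - t *: S by rewrite scalerN scaleNr.
  by rewrite (Ainv t x).
rewrite slope_eq opprK in slopeE.
exact: (cvg_unique _ slopeA slopeE).
Unshelve. all: by end_near. Qed.

(** * Regularity of the vector potential and bounds on bounded sets *)

Lemma classC1D (R : realType) (f g : 'cV[R]_3 -> R) :
  classC 1 f -> classC 1 g -> classC 1 (fun x => f x + g x).
Proof.
move=> [cf df] [cg dg]; split; first by move=> x; exact: cvgD (cf x) (cg x).
move=> j; have [fj [cfj _]] := df j; have [gj [cgj _]] := dg j.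
split; first by move=> x; exact: derivableD.
have -> : partial j (fun x => f x + g x) = (fun x => partial j f x + partial j g x).
  by apply/funext => x; exact: deriveD.
by split=> // x; exact: cvgD (cfj x) (cgj x).
Qed.

Lemma classC1Z (R : realType) (f : 'cV[R]_3 -> R) (c : R) :
  classC 1 f -> classC 1 (fun x => c * f x).
Proof.
move=> [cf df]; split; first by move=> x; exact: cvgM (cvg_cst _) (cf x).
move=> j; have [fj [cfj _]] := df j.
split; first by move=> x; exact: derivableZ.
have -> : partial j (fun x => c * f x) = (fun x => c * partial j f x).
  by apply/funext => x; exact: deriveZ.
by split=> // x; exact: cvgM (cvg_cst _) (cfj x).
Qed.

Lemma classC1_coord (R : realType) (k : 'I_3) :
  classC 1 (fun x : 'cV[R]_3 => x k 0).
Proof.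
split; first exact: coord_continuous.
move=> j; have dk (x : 'cV[R]_3) :
    derivable (fun x : 'cV[R]_3 => x k 0) x (delta_mx j 0).
  by apply: diff_derivable; exact: differentiable_coord.
split=> //; have -> : partial j (fun x : 'cV[R]_3 => x k 0) =
    cst ((delta_mx j 0 : 'cV[R]_3) k 0).
  apply/funext => x; rewrite /partial /cst.
  have did : derivable (id : 'cV[R]_3 -> 'cV[R]_3) x (delta_mx j 0).
    exact: derivable_id.
  have := derive_mx did.
  by rewrite derive_id => /colP /(_ k) ->; rewrite mxE.
by split=> //; exact: cst_continuous.
Qed.

Lemma vecpot_classC1 (R : realType) (B0 : 'cV[R]_3)
    (A1 : 'cV[R]_3 -> 'cV[R]_3) :
  smoothv A1 -> forall i, classC 1 (fun x => vecpot B0 A1 x i 0).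
Proof.
move=> A1s i.
have -> : (fun x => vecpot B0 A1 x i 0) = (fun x =>
    ((- (1 / 2) * B0 (i + 2%:R) 0) * x (i + 1) 0 +
     (1 / 2 * B0 (i + 1) 0) * x (i + 2%:R) 0) + A1 x i 0).
  by apply/funext => x; rewrite !mxE; ring.
by apply: classC1D; [apply: classC1D; apply: classC1Z; exact: classC1_coord
                    |exact: A1s].
Qed.

Lemma continuous_bounded_on_ball (R : realType) (V : normedModType R)
    (f : 'cV[R]_3 -> V) (r : R) :
  continuous f -> exists2 b, 0 <= b & forall x, `|x| <= r -> `|f x| <= b.
Proof.
move=> cf.
(* The ball is the image under transposition of this compact box. *)
have box_compact : compact [set v : 'rV[R]_3 | forall i, `[- r, r]%classic (v ord0 i)].
  apply: (@rV_compact _ _ (fun=> `[- r, r]%classic)) => i; exact: segment_compact.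
have tr_continuous (v : 'rV[R]_3) : w^T @[w --> v] --> v^T.
  apply: (cvg_mx_coord (nbhs_filter v) _ _).2 => i j; rewrite mxE.
  under eq_fun do rewrite mxE.
  exact: coord_continuous.
have /compact_bounded [b [_ Hb]] :
    compact ((fun v : 'rV[R]_3 => f v^T) @`
      [set v : 'rV[R]_3 | forall i, `[- r, r]%classic (v ord0 i)]).
  apply: continuous_compact box_compact; apply: continuous_subspaceT => v.
  exact: (cvg_comp _ _ (tr_continuous v) (cf _)).
exists (`|b| + 1) => [|x xr]; first by rewrite addr_ge0.
apply: (Hb (`|b| + 1)); first by rewrite (le_lt_trans (ler_norm b))// ltrDl.
exists x^T; last by rewrite trmxK.
move=> i; rewrite /= in_itv /= -ler_norml mxE.
exact: le_trans (norm_coord_le _ _ _) xr.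
Qed.

Lemma continuous_of_coords (R : realType) m n (T : topologicalType)
    (f : T -> 'M[R]_(m, n)) :
  (forall i j, continuous (fun x => f x i j)) -> continuous f.
Proof.
by move=> cf x; apply: (cvg_mx_coord (nbhs_filter x) _ _).2 => i j; exact: cf.
Qed.

Lemma jac_continuous (R : realType) (A : 'cV[R]_3 -> 'cV[R]_3) :
  (forall i, classC 1 (fun x => A x i 0)) -> continuous (jac A).
Proof.
move=> A1; apply: continuous_of_coords => i j.
rewrite (_ : (fun x => _) = partial j (fun y => A y i 0)); last first.
  by apply/funext => x; rewrite mxE.
exact: classC1_partial_continuous.
Qed.

(** The intermediate points of the mean value theorem leave the ball of radius
    [r], whence the radius of the ball on which the Jacobian is bounded. *)
Lemma lipschitz_on_ball (R : realType) (A : 'cV[R]_3 -> 'cV[R]_3) (r b : R) :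
  (forall i, classC 1 (fun x => A x i 0)) ->
  (forall x, `|x| <= 3%:R * r -> `|jac A x| <= b) ->
  forall p q, `|p| <= r -> `|q| <= r -> `|A p - A q| <= 3%:R * b * `|p - q|.
Proof.
move=> A1 Jb p q pr qr.
have r0 : 0 <= r by rewrite (le_trans _ pr).
have b0 : 0 <= b by rewrite (le_trans _ (Jb 0 _))// normr0 mulr_ge0.
apply: norm_mx_le => [|i j]; first by rewrite !mulr_ge0.
rewrite (ord1 j) !mxE.
have [xi xiP] := mean_value q (p - q) (A1 i).
rewrite /= [q + _]addrC subrK => ->; rewrite (le_trans (ler_norm_sum _ _ _))//.
have -> : 3%:R * b * `|p - q| = \sum_(k < 3) (b * `|p - q|).
  by rewrite sumr_const card_ord -mulrA mulr_natl.
apply: ler_sum => k _; rewrite normrM ler_pM ?norm_coord_le//.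
have -> : partial k (fun y => A y i 0) (xi k) = jac A (xi k) i k by rewrite mxE.
rewrite (le_trans (norm_coord_le _ _ _))// Jb//.
have := xiP k; have := ler_normB p q; have := ler_normD (xi k - q) q.
by rewrite subrK; lra.
Qed.

(** * Velocities along a bounded discrete trajectory *)

(** A particle whose velocity varies slowly and whose speed is large leaves
    every bounded set within a fixed time. At a step [m] where the speed is
    maximal, the preceding velocities are nearly equal to [y m] over a physical
    time of order [delta], so the displacement over that time is comparable to
    [delta * `|y m|] and confinement bounds the speed. If less time than that
    has elapsed since the start, [y m] is compared with [y 0] instead. A step
    longer than [delta] is itself a displacement of the required size. *)
Lemma bounded_trajectory_velocity (R : realType) (V : normedModType R)
    (kappa D Y0 h : R) (L : nat) (x y : nat -> V) :
  let delta := (8%:R * (kappa + 1))^-1 in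
  0 <= kappa -> 0 <= Y0 -> 0 < h ->
  (forall n, (n < L)%N -> x n.+1 - x n = h *: y n) ->
  (forall k l, (k <= L)%N -> (l <= L)%N -> `|x k - x l| <= D) ->
  (h <= delta -> `|y 0%N| <= Y0) ->
  (h <= delta -> forall n, (n.+1 < L)%N ->
    `|y n.+1 - y n| <= kappa * h * (`|y n.+1| + `|y n| + 1)) ->
  forall n, (n < L)%N -> `|y n| <= 1 + 2%:R * Y0 + 4%:R * (D / delta).
Proof.
move=> delta kappa0 Y00 h0 xy confined start slow n nL.
have delta0 : 0 < delta by rewrite invr_gt0; lra.
(* The factor 8 in [delta] makes the drift over a time [delta] smaller than a
   quarter of the maximal speed, up to a constant. *)
have kdelta : kappa * delta <= 8%:R^-1.
  have : (kappa + 1) * delta = 8%:R^-1 by rewrite /delta; field; lra.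
  by rewrite mulrDl; lra.
have D0 : 0 <= D by have := confined 0%N 0%N; rewrite subrr normr0; apply.
have Dd0 : 0 <= D / delta by rewrite divr_ge0 // ltW.
have [m mL mmax] : exists2 m, (m < L)%N & forall k, (k < L)%N -> `|y k| <= `|y m|.
  case: (@Order.TotalTheory.arg_maxP _ _ _ (Ordinal nL) xpredT
    (fun i : 'I_L => `|y i|)) => // i _ imax.
  by exists i => // k kL; exact: (imax (Ordinal kL)).
apply: le_trans (mmax _ nL) _; set Y := `|y m| in mmax *.
have Y_ge0 : 0 <= Y by exact: normr_ge0.
have [hd|hd] := leP h delta; last first.
  have : h * Y <= D.
    by rewrite -[h]gtr0_norm// -normrZ -xy//; apply: confined => //; exact: ltnW.
  move=> hY; have : Y <= D / delta.
    by rewrite ler_pdivlMr// mulrC (le_trans _ hY)// ler_wpM2r// ltW.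
  by lra.
pose q := kappa * (2%:R * Y + 1).
have q0 : 0 <= q by rewrite /q mulr_ge0//; lra.
have drift i j : (i + j < L)%N -> `|y (i + j)%N - y i| <= j%:R * h * q.
  elim: j => [|j IH] ijL; first by rewrite addn0 subrr normr0 !mul0r.
  have ijL' : (i + j < L)%N by rewrite addnS in ijL; exact: ltnW.
  rewrite -(subrKA (y (i + j)%N)) (le_trans (ler_normD _ _))//.
  rewrite -[j.+1%:R]natr1 2!mulrDl addrC mul1r lerD ?IH//.
  rewrite addnS in ijL *; apply: le_trans (slow hd _ ijL) _.
  rewrite /q mulrCA mulrA ler_wpM2l ?mulr_ge0 ?(ltW h0)//.
  by have := mmax _ ijL; have := mmax _ ijL'; lra.
have short j : j%:R * h <= delta -> j%:R * h * q <= (2%:R * Y + 1) / 8%:R.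
  move=> jd; apply: (@le_trans _ _ (delta * q)); first by rewrite ler_wpM2r.
  rewrite /q mulrA [delta * _]mulrC [leRHS]mulrC ler_wpM2r//; lra.
(* [J] steps last between [delta / 2] and [delta]. *)
pose J := Num.truncn (delta / h).
have dh0 : 0 <= delta / h by rewrite divr_ge0 ?ltW.
have Jle : J%:R * h <= delta.
  by rewrite -ler_pdivlMr// truncn_le.
have Jge : delta <= 2%:R * (J%:R * h).
  have J1 : (1 <= J)%N by rewrite truncn_gt0 ler_pdivlMr// mul1r.
  have : delta < J.+1%:R * h by rewrite -ltr_pdivrMr// truncnS_gt.
  rewrite -natr1 mulrDl mul1r => d1.
  have : 1 * h <= J%:R * h by rewrite ler_wpM2r ?(ltW h0)// ler1n.
  by lra.
have [mJ|Jm] := ltnP m J.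
  have m_short : m%:R * h <= delta.
    by rewrite (le_trans _ Jle)// ler_wpM2r ?(ltW h0)// ler_nat ltnW.
  have := drift 0%N m; rewrite add0n => /(_ mL) dm.
  have := short _ m_short; have := start hd.
  have : Y <= `|y m - y 0%N| + `|y 0%N|.
    by rewrite (le_trans _ (ler_normD _ _))// subrK.
  by lra.
have disp : forall j, (j <= J)%N ->
    `|x m - x (m - j)%N - (j%:R * h) *: y m| <=
    j%:R * h * ((2%:R * Y + 1) / 8%:R).
  elim=> [_|j IH jJ]; first by rewrite subn0 subrr mul0r scale0r subr0 normr0 mul0r.
  have jJ' := ltnW jJ; have jm : (j < m)%N by rewrite (leq_trans jJ).
  set k := (m - j.+1)%N; have kS : (m - j)%N = k.+1 by rewrite /k subnSK.
  have kL : (k < L)%N by rewrite (leq_ltn_trans (leq_subr _ _)).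
  have -> : x m - x k - (j.+1%:R * h) *: y m =
      (x m - x (m - j)%N - (j%:R * h) *: y m) + - (h *: (y m - y k)).
    rewrite kS -[x m - x k](subrKA (x k.+1)) xy// -natr1 mulrDl mul1r scalerDl opprD.
    by rewrite addrACA scalerBr opprB.
  rewrite (le_trans (ler_normD _ _))// -natr1 2!mulrDl mul1r lerD ?IH//.
  rewrite normrN normrZ gtr0_norm// ler_wpM2l ?(ltW h0)//.
  have mE : m = (k + j.+1)%N by rewrite /k subnK.
  have := drift k j.+1; rewrite -mE => /(_ mL) /le_trans; apply; apply: short.
  by rewrite (le_trans _ Jle)// ler_wpM2r ?(ltW h0)// ler_nat.
have {}disp := disp J (leqnn J).
have conf : `|x m - x (m - J)%N| <= D.
  by apply: confined; rewrite ?(leq_trans (leq_subr _ _))// ltnW.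
have Jh0 : 0 <= J%:R * h by rewrite mulr_ge0 ?(ltW h0).
have : J%:R * h * Y <= D + J%:R * h * ((2%:R * Y + 1) / 8%:R).
  rewrite -[J%:R * h]ger0_norm// -normrZ ger0_norm//.
  rewrite -[X in `|X| <= _](subKr (x m - x (m - J)%N)).
  by rewrite (le_trans (ler_normB _ _))// lerD.
have DE : D = D / delta * delta by rewrite divfK// gt_eqF.
rewrite {1}DE; set w := J%:R * h in Jge Jh0 *; set e := D / delta in Dd0 *.
move=> H; have ed : e * delta <= e * (2%:R * w) by rewrite ler_wpM2l.
have w0 : 0 < w by lra.
have : w * Y <= w * (2%:R * e + (2%:R * Y + 1) / 8%:R) by lra.
rewrite ler_pM2l//; lra.
Qed.

(** * The filters *)

Lemma sin_le_id (R : realType) (z : R) : 0 <= z -> sin z <= z.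
Proof.
move=> z0.
have cs : {within `[0, z], continuous (@sin R)}.
  by apply: continuous_subspaceT => x; exact: continuous_sin.
have [s _] := MVT_segment z0 (fun s _ => is_derive_sin s) cs.
rewrite sin0 !subr0 => ->.
by rewrite -[leRHS]mul1r ler_wpM2r// cos_le1.
Qed.

Section half_step.
Context {R : realType} (h : R).
Hypothesis hpi : 0 < h < pi.
Let z := h / 2.

Let z_gt0 : 0 < z. Proof. by rewrite divr_gt0//; case/andP: hpi. Qed.

Let sin_gt0 : 0 < sin z.
Proof.
by apply: sin_gt0_pihalf; rewrite z_gt0 /= ltr_pM2r ?invr_gt0//; case/andP: hpi.
Qed.

Let cos_gt0 : 0 < cos z.
Proof.
have zp : z < pi / 2 by rewrite ltr_pM2r ?invr_gt0//; case/andP: hpi.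
by apply: cos_gt0_pihalf; have := z_gt0; lra.
Qed.

Lemma tanc_half_gt0 : 0 < tanc (h / 2).
Proof. exact: divr_gt0 (divr_gt0 sin_gt0 cos_gt0) z_gt0. Qed.

(** For [h <= 1], [sin z <= z <= 1 / 2] and [cos z >= cos z ^+ 2 >= 3 / 4] with
    [z = h / 2]. *)
Lemma tanc_half_dist1 : h <= 1 -> `|1 - tanc (h / 2)| <= 1.
Proof.
move=> h1; have t0 := tanc_half_gt0.
suff : tanc (h / 2) <= 2 by rewrite ler_norml; lra.
rewrite /tanc /tan -/z ler_pdivrMr// ler_pdivrMr//.
have sz := sin_le_id (ltW z_gt0).
have z12 : z <= 1 / 2 by rewrite /z; lra.
have c1 := cos_le1 z; have cs := cos2Dsin2 z.
have s2 : sin z ^+ 2 <= 1 / 2 * (1 / 2).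
  by rewrite expr2 ler_pM ?(ltW sin_gt0)// (le_trans sz).
have cc : cos z ^+ 2 <= cos z.
  by rewrite expr2 -[leRHS]mulr1 ler_wpM2l// ltW.
have cge : z * 2^-1 <= z * cos z by rewrite ler_pM2l//; lra.
by lra.
Qed.

(** With [z = h / 2], the difference is [- z (1 - cos z) / sin z], that is
    [- z tan (z / 2)], which is of second order in [z]. *)
Lemma filters_close : `|(tanc (h / 2))^-1 - (sinc (h / 2))^-1| <= h ^+ 2.
Proof.
rewrite /tanc /sinc /tan -/z.
have sz := sin_le_id (ltW z_gt0); have cs := cos2Dsin2 z.
have c1 := cos_le1 z.
have -> : (sin z / cos z / z)^-1 - (sin z / z)^-1 = - (z * (1 - cos z) / sin z).
  by field; rewrite !gt_eqF.
rewrite normrN ger0_norm; last first.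
  by rewrite divr_ge0 ?(ltW sin_gt0)// mulr_ge0 ?(ltW z_gt0)// subr_ge0.
rewrite ler_pdivrMr//.
have hz : h = 2 * z by rewrite /z; field.
have : 1 - cos z <= z * sin z.
  apply: (@le_trans _ _ (sin z * sin z)); last by rewrite ler_pM2r.
  have : 0 <= cos z * (1 - cos z) by rewrite mulr_ge0 ?subr_ge0// ltW.
  by lra.
have := z_gt0; have := sin_gt0; rewrite hz => ? ? H.
have : z * (1 - cos z) <= z * (z * sin z) by rewrite ler_pM2l.
have : 0 <= z ^+ 2 * sin z by rewrite mulr_ge0 ?sqr_ge0 ?ltW.
by rewrite !expr2; lra.
Qed.

End half_step.

Lemma tildemx_sqr (R : realType) (B0 : 'cV[R]_3) :
  enorm B0 = 1 -> tildemx B0 ^+ 2 = B0 *m B0^T - 1%:M.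
Proof.
move=> nB.
have dec (k : 'I_3) : [\/ k = 0, k = 1 | k = 2%:R].
  by case: k => -[|[|[|//]]] Hk; [apply: Or31 | apply: Or32 | apply: Or33];
    apply/val_inj.
have E0 : ord0 = 0 :> 'I_3 by apply/val_inj.
have E1 : lift ord0 ord0 = 1 :> 'I_3 by apply/val_inj.
have E2 : lift ord0 (lift ord0 ord0) = 2%:R :> 'I_3 by apply/val_inj.
have F3 : 1 + 2%:R = 0 :> 'I_3 by apply/val_inj.
have F2 : 1 + 1 = 2%:R :> 'I_3 by apply/val_inj.
have F4 : 2%:R + 2%:R = 1 :> 'I_3 by apply/val_inj.
have F5 : 2%:R + 1 = 0 :> 'I_3 by apply/val_inj.
have B1 : B0 0 0 ^+ 2 + B0 1 0 ^+ 2 + B0 2%:R 0 ^+ 2 = 1.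
  have : enorm B0 ^+ 2 = 1 by rewrite nB expr1n.
  rewrite sqr_sqrtr; last by apply: sumr_ge0 => i _; exact: sqr_ge0.
  by rewrite !big_ord_recl big_ord0 ?E0 ?E1 ?E2 addr0 addrA.
apply/matrixP => i j; rewrite expr2 !mxE big_ord1 !mxE.
rewrite !big_ord_recl big_ord0 ?E0 ?E1 ?E2 !mxE.
by case: (dec i) => ->; case: (dec j) => ->;
  rewrite ?add0r ?F2 ?F3 ?F4 ?F5 /=; lra.
Qed.

Lemma tildemx_sqr_sym (R : realType) (B0 : 'cV[R]_3) :
  (tildemx B0 ^+ 2)^T = tildemx B0 ^+ 2.
Proof. by rewrite !expr2 -mulmxE trmx_mul tildemx_skew mulNmx mulmxN opprK. Qed.

(** [- tildemx B0 ^+ 2] is the projection onto the plane orthogonal to [B0]. *)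
Lemma tildemx_sqr_idem (R : realType) (B0 : 'cV[R]_3) : enorm B0 = 1 ->
  tildemx B0 ^+ 2 *m tildemx B0 ^+ 2 = - tildemx B0 ^+ 2.
Proof.
move=> nB; rewrite tildemx_sqr//.
have bb : B0^T *m B0 = 1%:M.
  have : enorm B0 ^+ 2 = 1 by rewrite nB expr1n.
  rewrite sqr_sqrtr; last by apply: sumr_ge0 => i _; exact: sqr_ge0.
  move=> E; apply/matrixP => i j; rewrite (ord1 i) (ord1 j) !mxE eqxx -E.
  by apply: eq_bigr => k _; rewrite mxE expr2.
rewrite mulmxBl mulmxBr mul1mx mulmx1 mulmxA -[_ *m B0^T *m B0]mulmxA bb mulmx1.
by rewrite subrr sub0r.
Qed.

(** [- tildemx B0 ^+ 2] being a projection, inverting [Psi] amounts to inverting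
    its eigenvalue [tanc (h / 2)]. *)
Definition Psi_inv (R : realType) (B0 : 'cV[R]_3) (h : R) : 'M[R]_3 :=
  1%:M + (1 - (tanc (h / 2))^-1) *: tildemx B0 ^+ 2.

Lemma Psi_invP (R : realType) (B0 : 'cV[R]_3) (h : R) :
  enorm B0 = 1 -> tanc (h / 2) != 0 -> Psi_inv B0 h *m Psi B0 h = 1%:M.
Proof.
move=> nB t0; rewrite /Psi_inv /Psi; set t := tanc _ in t0 *.
rewrite mulmxDl mul1mx mulmxDr mulmx1 -scalemxAl -scalemxAr tildemx_sqr_idem//.
rewrite !scalerN scalerA -!addrA -scalerBl -scalerDl.
have -> : 1 - t + (1 - t^-1 - (1 - t^-1) * (1 - t)) = 0 by field.
by rewrite scale0r addr0.
Qed.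

Lemma Psi_inv_sym (R : realType) (B0 : 'cV[R]_3) (h : R) :
  (Psi_inv B0 h)^T = Psi_inv B0 h.
Proof. by rewrite linearD linearZ /= tildemx_sqr_sym trmx1. Qed.

Lemma Psi_inv_comm (R : realType) (B0 : 'cV[R]_3) (h : R) (S : 'M[R]_3) :
  S *m tildemx B0 ^+ 2 = tildemx B0 ^+ 2 *m S ->
  S *m Psi_inv B0 h = Psi_inv B0 h *m S.
Proof.
move=> SG.
by rewrite mulmxDr mulmxDl mulmx1 mul1mx -scalemxAl -scalemxAr SG.
Qed.

Lemma norm_Psi_le (R : realType) (B0 : 'cV[R]_3) (h : R) :
  0 < h < pi -> h <= 1 -> `|Psi B0 h| <= 1 + `|tildemx B0 ^+ 2|.
Proof.
move=> hpi h1; rewrite (le_trans (ler_normD _ _))// lerD//.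
  apply: norm_mx_le => // i j.
  by rewrite mxE; case: eqP; rewrite ?normr1 ?normr0.
by rewrite normrZ -[leRHS]mul1r ler_wpM2r// tanc_half_dist1.
Qed.

Lemma Phi_sub_Psi_inv (R : realType) (B0 : 'cV[R]_3) (h : R) :
  Phi B0 h = Psi_inv B0 h +
    ((tanc (h / 2))^-1 - (sinc (h / 2))^-1) *: tildemx B0 ^+ 2.
Proof.
by rewrite /Phi /Psi_inv -addrA -scalerDl; congr (_ + _ *: _); rewrite subrKA.
Qed.

(** * The discrete Noether identity for one step *)

Definition skewform (R : realType) (S : 'M[R]_3) (u v : 'cV[R]_3) : R :=
  (u^T *m S *m v) 0 0.

Section skewform_theory.
Context {R : realType} (S : 'M[R]_3).
Implicit Types u v w : 'cV[R]_3.

Lemma skewformDl u v w : skewform S (u + v) w = skewform S u w + skewform S v w.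
Proof. by rewrite /skewform linearD /= !mulmxDl mxE. Qed.

Lemma skewformDr u v w : skewform S w (u + v) = skewform S w u + skewform S w v.
Proof. by rewrite /skewform mulmxDr mxE. Qed.

Lemma skewformZl c u v : skewform S (c *: u) v = c * skewform S u v.
Proof. by rewrite /skewform linearZ /= -!scalemxAl mxE. Qed.

Lemma skewformZr c u v : skewform S u (c *: v) = c * skewform S u v.
Proof. by rewrite /skewform -scalemxAr mxE. Qed.

Lemma skewformNl u v : skewform S (- u) v = - skewform S u v.
Proof. by rewrite -scaleN1r skewformZl mulN1r. Qed.

Lemma skewformNr u v : skewform S u (- v) = - skewform S u v.
Proof. by rewrite -scaleN1r skewformZr mulN1r. Qed.

Lemma skewform_trmx u v : skewform S^T u v = skewform S v u.
Proof.
rewrite /skewform -[in RHS](trmxK (v^T *m S *m u)) [RHS]mxE.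
by rewrite !trmx_mul trmxK mulmxA.
Qed.

Lemma norm_skewform_le u v : `|skewform S u v| <= 9%:R * `|S| * `|u| * `|v|.
Proof.
rewrite (le_trans (norm_coord_le _ _ _))// (le_trans (norm_mulmx_le _ _))//.
rewrite ler_wpM2r// (_ : 9%:R = 3%:R * 3%:R :> R); last by rewrite -natrM.
rewrite -!mulrA ler_wpM2l// [`|S| * _]mulrC !mulrA.
by rewrite (le_trans (norm_mulmx_le _ _))// norm_trmx.
Qed.

End skewform_theory.

Lemma skewform_anti (R : realType) (S : 'M[R]_3) u v :
  S^T = - S -> skewform S u v = - skewform S v u.
Proof.
by move=> SS; rewrite -[LHS]skewform_trmx SS /skewform mulmxN mulNmx [LHS]mxE.
Qed.

(** Here [a], [f] and [J] stand for the vector potential, the force and the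
    Jacobian of the vector potential at the midpoint [m].
    A step from [m - w / 2] to [m + w / 2] with velocity [u = w / h] has two
    discrete momenta, the derivatives of the discrete Lagrangian in its two
    end points. Invariance of the Lagrangian under the flow of [S] makes their
    pairings with the generator [S x] equal. When both are expanded at [m], the
    terms linear in [w] that involve [J] and [a] cancel by equivariance of the
    potential, and the pairing of [Q u] with [S w] vanishes because [Q S] is
    skew-symmetric. *)
Section noether_step.
Context {R : realType} (S Q J : 'M[R]_3) (u m a f : 'cV[R]_3) (h : R).
Hypotheses (S_skew : S^T = - S) (Q_sym : Q^T = Q) (SQ : S *m Q = Q *m S).
Hypotheses (J_equivariant : J *m (S *m m) = S *m a).
Hypothesis (f_tangent : f^T *m (S *m m) = 0).

Let w := h *: u.

Definition midpoint_momentum : R :=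
  skewform S (Q *m u + a) m
  + 1 / 4%:R * skewform S (J^T *m w) w + h / 4%:R * skewform S f w.

Let kinetic : skewform S (Q *m u) u = 0.
Proof.
have : skewform S (Q *m u) u = - skewform S (Q *m u) u.
  rewrite [RHS](_ : _ = skewform S u (Q *m u)); last first.
    by rewrite [RHS]skewform_anti.
  by rewrite /skewform trmx_mul Q_sym -!mulmxA (mulmxA Q) -SQ !mulmxA.
by lra.
Qed.

Let transport : skewform S (J^T *m w) m = - skewform S a w.
Proof.
rewrite [in RHS]skewform_anti// opprK /skewform trmx_mul trmxK.
by rewrite -!mulmxA J_equivariant.
Qed.

Let tangent : skewform S f m = 0.
Proof. by rewrite /skewform -mulmxA f_tangent mxE. Qed.

Lemma left_momentum :
  skewform S (Q *m u - (1 / 2) *: (J^T *m w) + a - (h / 2) *: f)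
    (m - (1 / 2) *: w) = midpoint_momentum.
Proof.
have kin : skewform S (Q *m u) w = 0 by rewrite skewformZr kinetic mulr0.
rewrite /midpoint_momentum.
rewrite !(skewformDl, skewformDr, skewformNl, skewformNr, skewformZl).
rewrite !(skewformZr S (1 / 2)) kin transport tangent; lra.
Qed.

Lemma right_momentum :
  skewform S (Q *m u + (1 / 2) *: (J^T *m w) + a + (h / 2) *: f)
    (m + (1 / 2) *: w) = midpoint_momentum.
Proof.
have kin : skewform S (Q *m u) w = 0 by rewrite skewformZr kinetic mulr0.
rewrite /midpoint_momentum.
rewrite !(skewformDl, skewformDr, skewformNl, skewformNr, skewformZl).
rewrite !(skewformZr S (1 / 2)) kin transport tangent; lra.
Qed.

End noether_step.

(** * The integrator *)

Section trajectory.
Context {R : realType} (B0 : 'cV[R]_3) (A F : 'cV[R]_3 -> 'cV[R]_3).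
Context (h : R) (L : nat) (x v : nat -> 'cV[R]_3).
Hypotheses (h_gt0 : 0 < h) (fvi : FVI B0 A F h L x v).

Let u n := h^-1 *: (x n.+1 - x n).
Let m n := midpt x n.

Let h_neq0 : h != 0. Proof. by rewrite gt_eqF. Qed.

Lemma scale_velocity n : h *: u n = x n.+1 - x n.
Proof. by rewrite /u scalerA mulfV// scale1r. Qed.

Lemma midpt_left n : x n = m n - (1 / 2) *: (h *: u n).
Proof.
by apply/matrixP => i j; rewrite scale_velocity /m /midpt !mxE; field.
Qed.

Lemma midpt_right n : x n.+1 = m n + (1 / 2) *: (h *: u n).
Proof.
by apply/matrixP => i j; rewrite scale_velocity /m /midpt !mxE; field.
Qed.

Lemma FVI_first_velocity :
  u 0%N = Psi B0 h *m
    ((v 0%N + A (x 0%N)) + (1 / 2) *: ((jac A (m 0%N))^T *m (h *: u 0%N))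
     - A (m 0%N) + (h / 2) *: F (m 0%N)).
Proof.
rewrite scale_velocity [LHS]/u [x 1%N in LHS](FVI_start fvi).
by rewrite [x 0%N + _]addrC addrK scalerA mulVf// scale1r.
Qed.

Lemma FVI_velocity_increment n : (n.+1 < L)%N ->
  u n.+1 - u n = Psi B0 h *m
    ((1 / 2) *: ((jac A (m n.+1))^T *m (h *: u n.+1))
     + (1 / 2) *: ((jac A (m n))^T *m (h *: u n))
     - (A (m n.+1) - A (m n)) + (h / 2) *: (F (m n.+1) + F (m n))).
Proof.
move=> nL; have := FVI_step fvi (n := n.+1); rewrite nL => /(_ isT) /=.
rewrite -/(m n.+1) -/(m n) => step; apply: (scalerI h_neq0).
rewrite scalemxAr scalerBr !scale_velocity.
have -> : x n.+2 - x n.+1 - (x n.+1 - x n) = x n.+2 - 2 *: x n.+1 + x n.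
  by apply/matrixP => i j; rewrite !mxE; ring.
rewrite step; congr (_ *m _).
rewrite [RHS]scalerDr [X in _ = X + _]scalerBr [X in _ = X - _ + _]scalerDr.
by rewrite !scalerA mulrCA mul1r mulrA -expr2.
Qed.

(** Multiplied by [Psi_inv], the recursion is the discrete
    Euler-Lagrange equation: the two momenta attached to a node agree. *)
Lemma FVI_momenta_match n : enorm B0 = 1 -> tanc (h / 2) != 0 ->
  (n.+1 < L)%N ->
  Psi_inv B0 h *m u n.+1 - (1 / 2) *: ((jac A (m n.+1))^T *m (h *: u n.+1))
    + A (m n.+1) - (h / 2) *: F (m n.+1) =
  Psi_inv B0 h *m u n + (1 / 2) *: ((jac A (m n))^T *m (h *: u n))
    + A (m n) + (h / 2) *: F (m n).
Proof.
move=> nB t0 nL.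
have -> : u n.+1 = u n + (u n.+1 - u n) by rewrite addrC subrK.
rewrite {1}(FVI_velocity_increment nL) mulmxDr mulmxA Psi_invP// mul1mx.
rewrite [u n + _]addrC subrK.
by apply/matrixP => i j; rewrite !mxE; ring.
Qed.

Definition discrete_momentum (S : 'M[R]_3) (n : nat) : R :=
  midpoint_momentum S (Psi_inv B0 h) (jac A (m n)) (u n) (m n)
    (A (m n)) (F (m n)) h.

(** The right momentum of a step and the left momentum of the next one are the
    same vector, paired with [S] at the same node. *)
Lemma discrete_momentum_constant (S : 'M[R]_3) n :
  enorm B0 = 1 -> tanc (h / 2) != 0 -> S^T = - S ->
  S *m tildemx B0 ^+ 2 = tildemx B0 ^+ 2 *m S ->
  (forall y, jac A y *m (S *m y) = S *m A y) ->
  (forall y, (F y)^T *m (S *m y) = 0) ->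
  (n < L)%N -> discrete_momentum S n = discrete_momentum S 0%N.
Proof.
move=> nB t0 SS SG SA SF; have SQ := Psi_inv_comm h SG.
elim: n => // n IH nL; rewrite -IH; last exact: ltnW.
rewrite /discrete_momentum.
rewrite -(left_momentum (u n.+1) h SS (Psi_inv_sym _ _) SQ (SA _) (SF _)).
rewrite -(right_momentum (u n) h SS (Psi_inv_sym _ _) SQ (SA _) (SF _)).
by rewrite FVI_momenta_match// -midpt_left -midpt_right.
Qed.

End trajectory.

(** The Noether invariant differs from the physical momentum by the filter
    defect, of order [h ^+ 2], and by two terms containing two factors
    [h *: u]. *)
Lemma momentum_defect (R : realType) (B0 : 'cV[R]_3)
    (A : 'cV[R]_3 -> 'cV[R]_3) (S J : 'M[R]_3) (m u f : 'cV[R]_3)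
    (h r bJ bF Y : R) :
  0 < h < pi -> `|m| <= r -> `|J| <= bJ -> `|f| <= bF -> `|u| <= Y ->
  `|momentum A S m (Phi B0 h *m u)
    - midpoint_momentum S (Psi_inv B0 h) J u m (A m) f h| <=
  9%:R * `|S| * (3%:R * `|tildemx B0 ^+ 2| * Y * r + 3%:R * bJ * Y * Y + bF * Y)
  * h ^+ 2.
Proof.
move=> hpi mr JbJ fbF uY; have h0 : 0 < h by case/andP: hpi.
have Y0 : 0 <= Y by rewrite (le_trans _ uY).
have bJ0 : 0 <= bJ by rewrite (le_trans _ JbJ).
have bF0 : 0 <= bF by rewrite (le_trans _ fbF).
have r0 : 0 <= r by rewrite (le_trans _ mr).
set G := tildemx B0 ^+ 2; set s := `|S|.
have s0 : 0 <= s by exact: normr_ge0.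
rewrite /momentum -/(skewform S _ m) /midpoint_momentum Phi_sub_Psi_inv -/G.
set c := (tanc _)^-1 - _.
have ch : `|c| <= h ^+ 2 by exact: filters_close.
rewrite mulmxDl -scalemxAl !skewformDl skewformZl !skewformZr.
rewrite -scalemxAr skewformZl.
set a1 := skewform S (Psi_inv _ _ *m u) m; set a2 := skewform S (A m) m.
set d1 := skewform S (G *m u) m; set d2 := skewform S (J^T *m u) u.
set d3 := skewform S f u.
have -> : a1 + c * d1 + a2 - (a1 + a2 + 1 / 4%:R * (h * (h * d2)) +
    h / 4%:R * (h * d3)) = c * d1 - h ^+ 2 * (d2 / 4%:R + d3 / 4%:R) by field.
have d1le : `|d1| <= 9%:R * s * (3%:R * `|G| * Y * r).
  rewrite (le_trans (norm_skewform_le _ _ _))// -!/s -mulrA ler_wpM2l ?mulr_ge0//.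
  by rewrite ler_pM// (le_trans (norm_mulmx_le _ _))// ler_wpM2l ?mulr_ge0.
have d2le : `|d2| <= 9%:R * s * (3%:R * bJ * Y * Y).
  rewrite (le_trans (norm_skewform_le _ _ _))// -!/s -mulrA ler_wpM2l ?mulr_ge0//.
  rewrite ler_pM// (le_trans (norm_mulmx_le _ _))// norm_trmx.
  by rewrite ler_pM ?mulr_ge0// ler_wpM2l.
have d3le : `|d3| <= 9%:R * s * (bF * Y).
  rewrite (le_trans (norm_skewform_le _ _ _))// -!/s -mulrA ler_wpM2l ?mulr_ge0//.
  by rewrite ler_pM.
set e1 := _ * (_ * r) in d1le; set e2 := 9%:R * s * _ in d2le.
set e3 := 9%:R * s * _ in d3le.
rewrite ![in leRHS]mulrDr -/e1 -/e2 -/e3.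
have h2 : 0 <= h ^+ 2 by exact: sqr_ge0.
rewrite (le_trans (ler_normB _ _))// [`|c * _|]normrM [`|h ^+ 2 * _|]normrM.
rewrite [`|h ^+ 2|]ger0_norm//.
have cd : `|c| * `|d1| <= h ^+ 2 * e1 by rewrite ler_pM.
have : `|d2 / 4%:R + d3 / 4%:R| <= e2 + e3.
  rewrite (le_trans (ler_normD _ _))// !normrM !normfV !(@ger0_norm _ 4%:R)//.
  by have := normr_ge0 d2; have := normr_ge0 d3; lra.
move=> d23; have : h ^+ 2 * `|d2 / 4%:R + d3 / 4%:R| <= h ^+ 2 * (e2 + e3).
  by rewrite ler_wpM2l.
by lra.
Qed.

(** * Bounded velocities and near-conservation of the momentum *)

Lemma midpt_norm_le (R : realType) (z : nat -> 'cV[R]_3) n (r : R) :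
  `|z n| <= r -> `|z n.+1| <= r -> `|midpt z n| <= r.
Proof.
move=> zr zr'; rewrite /midpt normrZ ger0_norm ?divr_ge0//.
by have := ler_normD (z n) (z n.+1); lra.
Qed.

(** For [h <= 1] the filter [Psi] is bounded, and the Lipschitz bound on [A]
    turns the recursion into the slow variation of the velocity required by
    [bounded_trajectory_velocity]. The starting formula controls [u 0], since
    [h *: u 0] is a difference of two confined positions. *)
Lemma FVI_velocity_bound (R : realType) (B0 : 'cV[R]_3)
    (A F : 'cV[R]_3 -> 'cV[R]_3) (r Chat bA bJ bF : R) :
  (forall i, classC 1 (fun x => A x i 0)) ->
  0 <= r -> 0 <= Chat -> 0 <= bF ->
  (forall x, `|x| <= 3%:R * r -> `|jac A x| <= bJ) ->
  (forall x, `|x| <= r -> `|A x| <= bA) ->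
  (forall x, `|F x| <= bF) ->
  exists Y : R, forall (h : R) (L : nat) (x v : nat -> 'cV[R]_3),
    0 < h < pi -> `|v 0%N| <= Chat -> FVI B0 A F h L x v ->
    (forall n, (n <= L)%N -> `|x n| <= r) ->
    forall n, (n < L)%N -> `|h^-1 *: (x n.+1 - x n)| <= Y.
Proof.
move=> A1 r0 C0 bF0 JbJ AbA FbF.
have bJ0 : 0 <= bJ by rewrite (le_trans _ (JbJ 0 _))// normr0 mulr_ge0.
have bA0 : 0 <= bA by rewrite (le_trans _ (AbA 0 _))// normr0.
have JbJ' y : `|y| <= r -> `|jac A y| <= bJ by move=> yr; apply: JbJ; lra.
set g := `|tildemx B0 ^+ 2|.
pose P := 3%:R * (1 + g).
have P0 : 0 <= P by rewrite mulr_ge0// addr_ge0// normr_ge0.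
have half (z : 'cV[R]_3) : `|(1 / 2) *: z| = `|z| / 2.
  by rewrite normrZ ger0_norm ?divr_ge0// mul1r mulrC.
have bound_start : 0 <= P * (Chat + 2 * bA + 3%:R * bJ * r + bF).
  have : 0 <= 3%:R * bJ * r by rewrite !mulr_ge0.
  by move=> ?; rewrite mulr_ge0//; lra.
pose kappa := P * (4%:R * bJ + bF).
have kappa0 : 0 <= kappa by rewrite mulr_ge0// addr_ge0// mulr_ge0.
exists (1 + 2%:R * (P * (Chat + 2 * bA + 3%:R * bJ * r + bF)) +
  4%:R * (2 * r / (8%:R * (kappa + 1))^-1)).
move=> h L x v hpi vC fvi xr n nL.
have h0 : 0 < h by case/andP: hpi.
have mr k : (k < L)%N -> `|midpt x k| <= r.
  by move=> kL; apply: midpt_norm_le; apply: xr; rewrite // ltnW.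
have delta1 : (8%:R * (kappa + 1))^-1 <= 1.
  by rewrite invf_le1; lra.
pose u k := h^-1 *: (x k.+1 - x k).
have uE k : h *: u k = x k.+1 - x k by exact: scale_velocity.
have confined k l : (k <= L)%N -> (l <= L)%N -> `|x k - x l| <= 2 * r.
  by move=> kL lL; have := ler_normB (x k) (x l); have := xr _ kL;
    have := xr _ lL; lra.
have Jw k : (k < L)%N ->
    `|(jac A (midpt x k))^T *m (h *: u k)| <= 3%:R * bJ * `|h *: u k|.
  move=> kL; rewrite (le_trans (norm_mulmx_le _ _))// norm_trmx.
  by rewrite ler_wpM2r// ler_wpM2l// JbJ' ?mr.
have PsiP (z : 'cV[R]_3) : h <= 1 -> `|Psi B0 h *m z| <= P * `|z|.
  move=> h1; rewrite (le_trans (norm_mulmx_le _ _))// ler_wpM2r//.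
  by rewrite ler_wpM2l// norm_Psi_le.
apply: (@bounded_trajectory_velocity _ _ kappa (2 * r) _ h L x u) => //.
- move=> hd; have h1 := le_trans hd delta1.
  have L0 : (0 < L)%N by exact: leq_ltn_trans nL.
  rewrite /u (FVI_first_velocity h0 fvi) (le_trans (PsiP _ h1))// ler_wpM2l//.
  rewrite (le_trans (ler_normD _ _))// normrZ ger0_norm ?divr_ge0 ?(ltW h0)//.
  have fF : h / 2 * `|F (midpt x 0%N)| <= bF.
    by rewrite -[leRHS]mul1r ler_pM ?divr_ge0 ?(ltW h0)//; lra.
  rewrite lerD// (le_trans (ler_normB _ _))//.
  rewrite [leRHS](_ : _ = Chat + bA + 3%:R * bJ * r + bA); last by ring.
  rewrite lerD ?AbA ?mr// (le_trans (ler_normD _ _))// lerD//.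
    by rewrite (le_trans (ler_normD _ _))// lerD// AbA// xr.
  rewrite half ler_pdivrMr//; apply: le_trans (Jw _ L0) _.
  have := confined 1%N 0%N L0 (leq0n _); rewrite -uE => wr.
  by rewrite -[leRHS]mulrA [r * 2]mulrC ler_wpM2l// mulr_ge0.
move=> hd k kL; have h1 := le_trans hd delta1; have kL' := ltnW kL.
rewrite /u (FVI_velocity_increment h0 fvi kL) (le_trans (PsiP _ h1))//.
rewrite -/(u k) -/(u k.+1).
rewrite [leRHS](_ : _ =
  P * ((4%:R * bJ + bF) * h * (`|u k.+1| + `|u k| + 1))); last first.
  by rewrite /kappa; ring.
rewrite ler_wpM2l//.
have dA : `|A (midpt x k.+1) - A (midpt x k)| <=
    3%:R * bJ * (h * ((`|u k.+1| + `|u k|) / 2)).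
  apply: le_trans (lipschitz_on_ball A1 JbJ (mr _ kL) (mr _ kL')) _.
  rewrite ler_wpM2l ?mulr_ge0//.
  have -> : midpt x k.+1 - midpt x k = (1 / 2) *: (h *: (u k.+1 + u k)).
    rewrite scalerDr !uE.
    by apply/matrixP => i j; rewrite /midpt !mxE; field.
  rewrite half normrZ gtr0_norm// -mulrA ler_wpM2l ?(ltW h0)// ler_wpM2r//.
  exact: ler_normD.
have fF : `|(h / 2) *: (F (midpt x k.+1) + F (midpt x k))| <= h * bF.
  rewrite normrZ ger0_norm ?divr_ge0 ?(ltW h0)// -mulrA ler_wpM2l ?(ltW h0)//.
  have := ler_normD (F (midpt x k.+1)) (F (midpt x k)).
  by have := FbF (midpt x k.+1); have := FbF (midpt x k); lra.
have hu j : `|h *: u j| = h * `|u j| by rewrite normrZ gtr0_norm.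
have := Jw _ kL; have := Jw _ kL'; rewrite !hu => J1 J2.
have triangle (p q e f : 'cV[R]_3) :
    `|p + q - e + f| <= `|p| + `|q| + `|e| + `|f|.
  have := ler_normD (p + q - e) f; have := ler_normB (p + q) e.
  by have := ler_normD p q; lra.
apply: le_trans (triangle _ _ _ _) _; rewrite !half.
set a := `|u k.+1| in dA J2 *; set b := `|u k| in dA J1 *.
have a0 : 0 <= a by exact: normr_ge0.
have b0 : 0 <= b by exact: normr_ge0.
have e1 : 0 <= h * bJ * a by rewrite !mulr_ge0 ?(ltW h0).
have e2 : 0 <= h * bJ * b by rewrite !mulr_ge0 ?(ltW h0).
have e3 : 0 <= h * bJ by rewrite !mulr_ge0 ?(ltW h0).
have e4 : 0 <= h * bF * a by rewrite !mulr_ge0 ?(ltW h0).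
have e5 : 0 <= h * bF * b by rewrite !mulr_ge0 ?(ltW h0).
by lra.
Qed.

Theorem theorem3p3 (R : realType)
  (B0 : 'cV[R]_3) (B1 A1 F : 'cV[R]_3 -> 'cV[R]_3) (U : 'cV[R]_3 -> R)
  (B0_unit : enorm B0 = 1)
  (B1_smooth : smoothv B1) (B1_bounded : boundedv B1)
  (B1_nonconstant : ~ exists b : 'cV[R]_3, forall x, B1 x = b)
  (A1_smooth : smoothv A1) (A1_potential : forall x, B1 x = curl A1 x)
  (F_smooth : smoothv F) (F_bounded : boundedv F)
  (U_smooth : smooth U) (F_potential : forall x, F x = - grad U x)
  (S : 'M[R]_3) (S_skew : S^T = - S)
  (U_invariant : forall (tau : R) (x : 'cV[R]_3),
     U (expmx (tau *: S) *m x) = U x)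
  (A_invariant : forall (tau : R) (x : 'cV[R]_3),
     expmx (- tau *: S) *m vecpot B0 A1 (expmx (tau *: S) *m x)
     = vecpot B0 A1 x)
  (S_comm : S *m tildemx B0 ^+ 2 = tildemx B0 ^+ 2 *m S)
  (N : nat) (N_ge3 : (3 <= N)%N)
  (Chat : R) (K : set 'cV[R]_3) (K_compact : compact K)
  (c : R) (c_gt0 : 0 < c) :
  exists C : R,
    forall (h : R) (L : nat) (x v : nat -> 'cV[R]_3),
      0 < h < pi ->
      enorm (x 0%N) <= Chat -> enorm (v 0%N) <= Chat ->
      FVI B0 (vecpot B0 A1) F h L x v ->
      (forall n : nat, (n <= L)%N -> K (x n)) ->
      forall n : nat, (n < L)%N ->
        n%:R * h <= c * h ^ (- N%:Z + 2) ->
        `| momentum (vecpot B0 A1) S (midpt x n) (midpt v n)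
           - momentum (vecpot B0 A1) S (midpt x 0%N) (midpt v 0%N) | <= C * h ^+ 2.

Proof.
set A := vecpot B0 A1.
have A_C1 : forall i, classC 1 (fun x => A x i 0) by exact: vecpot_classC1.
have A_eq : forall x, jac A x *m (S *m x) = S *m A x.
  exact: equivariant_jacobian.
have F_tan x : (F x)^T *m (S *m x) = 0.
  rewrite F_potential linearN /= mulNmx.
  by rewrite (invariant_gradient (U_smooth 1%N) U_invariant) oppr0.
have [r r0 Kr] : exists2 r, 0 <= r & forall x, K x -> `|x| <= r.
  have /compact_bounded [b [_ Hb]] := K_compact.
  exists (`|b| + 1) => [|x Kx]; first by rewrite addr_ge0.
  by apply: (Hb (`|b| + 1)) => //; rewrite (le_lt_trans (ler_norm b))// ltrDl.
have [bJ bJ0 JbJ] := continuous_bounded_on_ball (3%:R * r) (jac_continuous A_C1).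
have A_cont : continuous A.
  by apply: continuous_of_coords => i j x; rewrite (ord1 j); have [] := A_C1 i.
have [bA bA0 AbA] := continuous_bounded_on_ball r A_cont.
have [bF FbF] := F_bounded.
have FbF' x : `|F x| <= bF by exact: le_trans (norm_le_enorm _) (FbF x).
have bF0 : 0 <= bF by rewrite (le_trans _ (FbF' 0)).
have [Y vel] := FVI_velocity_bound B0 A_C1 r0 (normr_ge0 Chat) bF0 JbJ AbA FbF'.
pose d := 9%:R * `|S| *
  (3%:R * `|tildemx B0 ^+ 2| * Y * r + 3%:R * bJ * Y * Y + bF * Y).
exists (d + d) => h L x v hpi _ v0C fvi xK n nL _.
have h0 : 0 < h by case/andP: hpi.
have t0 : tanc (h / 2) != 0 by rewrite gt_eqF// tanc_half_gt0.
have xr k : (k <= L)%N -> `|x k| <= r by move=> kL; exact/Kr/xK.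
have v0 : `|v 0%N| <= `|Chat|.
  by rewrite (le_trans (norm_le_enorm _))// (le_trans v0C)// ler_norm.
have defect k : (k < L)%N ->
    `|momentum A S (midpt x k) (midpt v k) -
      discrete_momentum B0 A F h x S k| <= d * h ^+ 2.
  move=> kL; have mr : `|midpt x k| <= r.
    by apply: midpt_norm_le; apply: xr; rewrite // ltnW.
  rewrite (FVI_velocity fvi kL); apply: momentum_defect => //.
  - by apply: JbJ; lra.
  - exact: (vel h L x v).
have cons : discrete_momentum B0 A F h x S n =
    discrete_momentum B0 A F h x S 0%N.
  exact: (discrete_momentum_constant h0 fvi B0_unit t0 S_skew S_comm A_eq F_tan).
rewrite -(subrKA (discrete_momentum B0 A F h x S n)) (le_trans (ler_normD _ _))//.
rewrite mulrDl lerD ?defect// cons distrC defect//.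
exact: leq_ltn_trans nL.
Qed.
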